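(* Let $\eta_k := \prod_{j=1}^k(1-2^{-j})$ for $k\in\mathbb{Z}_{\ge0}\cup\{\infty\}$ and \[ \gamma := \sum_{j=0}^\infty\frac{2^{-j^2}\,\eta_\infty\,\eta_j^{-2}}{2^{j+1}-1}. \] Then $\gamma=\frac12$.
   Context: All notation is defined in the claim; the empty product $\eta_0$ equals $1$. *)

(* Defs.v *)
From mathcomp Require Import all_boot all_order all_algebra.
From mathcomp Require Import all_classical all_reals all_analysis.

Set Implicit Arguments.
Unset Strict Implicit.
Unset Printing Implicit Defensive.

Import Order.TTheory GRing.Theory Num.Theory.
Import numFieldNormedType.Exports.

Local Open Scope classical_set_scope.
Local Open Scope ring_scope.

Definition eta (R : realType) (k : nat) : R :=
  \prod_(1 <= j < k.+1) (1 - 2 ^- j).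

Definition eta_infty (R : realType) : R := limn (@eta R).

Definition gamma_term (R : realType) (j : nat) : R :=
  2 ^- (j ^ 2)%N * eta_infty R * eta R j ^- 2 / (2 ^+ j.+1 - 1).

(* [limn] is total, so [gamma] and [eta_infty] are meaningful only together
   with convergence of the underlying sequences. *)
Definition gamma (R : realType) : R := limn (series (@gamma_term R)).

(* Main.v *)
Require Import Defs.
From mathcomp Require Import all_boot all_order all_algebra.
From mathcomp Require Import all_classical all_reals all_analysis.
From mathcomp Require Import zify ring lra.

Import Order.TTheory GRing.Theory Num.Theory.
Import numFieldNormedType.Exports.

Local Open Scope classical_set_scope.
Local Open Scope ring_scope.

(** With [q = 1/2], the [j]-th term of [gamma] is [q * eta_infty] times
    [q^(j(j+1)) / (eta_j * eta_(j+1))], so the claim is the Durfee rectangle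
    identity [\sum_j q^(j(j+m)) / (eta_j * eta_(j+m)) = 1 / eta_infty] at
    [m = 1].  Its left side does not depend on [m], because the summands for
    [m] and [m+1] differ by a telescoping term; as [m] grows only the summand
    [j = 0], which is [1 / eta_m], survives.  Taking [m] equal to the number of
    summands controls both errors by a multiple of [q^m]. *)

Definition durfee_term {R : realType} (m j : nat) : R :=
  2 ^- (j * (j + m)) / (eta R j * eta R (j + m)).

Section DurfeeRectangle.
Set Implicit Arguments.
Unset Strict Implicit.
Context {R : realType}.
Implicit Types j k m n : nat.

Lemma eta0 : eta R 0 = 1.
Proof. by rewrite /eta big_geq. Qed.

Lemma etaS k : eta R k.+1 = eta R k * (1 - 2 ^- k.+1).
Proof. by rewrite /eta big_nat_recr. Qed.

Lemma expV2_gt0 n : 0 < 2 ^- n :> R.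
Proof. by rewrite invr_gt0 exprn_gt0. Qed.

Lemma expV2S n : 2 ^- n.+1 = 2 ^- n / 2 :> R.
Proof. by rewrite exprSr invfM mulrC. Qed.

Lemma expV2D m n : 2 ^- (m + n) = 2 ^- m * 2 ^- n :> R.
Proof. by rewrite exprD invfM. Qed.

Lemma ler_expV2 m n : (m <= n)%N -> 2 ^- n <= 2 ^- m :> R.
Proof.
by move=> lemn; rewrite lef_pV2 ?posrE ?exprn_gt0// ler_weXn2l// ler1n.
Qed.

Lemma expV2_le1 n : 2 ^- n <= 1 :> R.
Proof. by rewrite -[leRHS]invr1 -[in leRHS](expr0 2) ler_expV2. Qed.

Lemma expV2S_lt1 n : 2 ^- n.+1 < 1 :> R.
Proof. by rewrite expV2S; have := expV2_le1 n; have := expV2_gt0 n; lra. Qed.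

(* The extra summand [2 ^- k.+1] makes the lower bound [1 / 4] inductive. *)
Lemma eta_ge k : 1 / 4 + 2 ^- k.+1 <= eta R k.
Proof.
elim: k => [|[|k] IHk]; first by rewrite eta0 expr1; lra.
  by rewrite etaS eta0 !exprS expr0; lra.
(* With [x = 2 ^- k.+2], the step needs [(1/4 + x)(1 - x) >= 1/4 + x/2], which for positive [x]
   means [x <= 1/4]. Passing from [eta_0] to [eta_1] has [x = 1/2], hence the separate case
   above. *)
rewrite etaS [in leLHS]expV2S; move: IHk.
have := ler_expV2 (isT : 2 <= k.+2)%N; have := expV2_gt0 k.+2.
rewrite [2 ^- 2]expV2S [2 ^- 1]expV2S expr0 invr1.
move: (2 ^- k.+2) (eta R k.+1) => x e; nra.
Qed.

Lemma eta_gt0 k : 0 < eta R k.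
Proof. by have := eta_ge k; have := expV2_gt0 k.+1; lra. Qed.

Lemma eta_neq0 k : eta R k != 0.
Proof. by rewrite gt_eqF ?eta_gt0. Qed.

Lemma cvgn_eta : cvgn (@eta R).
Proof.
apply: (@nonincreasing_is_cvgn _ (@eta R)).
  apply/nonincreasing_seqP => k.
  by rewrite etaS ler_piMr ?gerBl// ltW ?eta_gt0 ?expV2_gt0.
by exists 0 => _ [k _ <-]; exact/ltW/eta_gt0.
Qed.

Lemma eta_infty_gt0 : 0 < eta_infty R.
Proof.
(* Positivity of each [eta R k] would only give a nonnegative limit; the uniform bound [1 / 4] keeps
   it away from 0. *)
apply: (@lt_le_trans _ _ (1 / 4)); first lra.
apply: limr_ge; first exact: cvgn_eta.
by apply: nearW => k; have := eta_ge k; have := expV2_gt0 k.+1; lra.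
Qed.

Lemma durfee_term0 m : durfee_term m 0 = (eta R m)^-1.
Proof. by rewrite /durfee_term mul0n add0n expr0 eta0 invr1 !mul1r. Qed.

Lemma durfee_term_ge0 m j : 0 <= durfee_term m j :> R.
Proof.
by rewrite divr_ge0 ?mulr_ge0// ltW ?eta_gt0 ?expV2_gt0.
Qed.

(** Each of the two [eta] factors in the denominator exceeds [1 / 4], hence the constant 16. *)
Lemma durfee_term_le m j : durfee_term m j <= 16 * 2 ^- (j * (j + m)) :> R.
Proof.
rewrite /durfee_term ler_pdivrMr ?mulr_gt0 ?eta_gt0//.
rewrite -mulrA mulrCA ler_peMr ?ltW ?expV2_gt0//.
have := eta_ge j; have := eta_ge (j + m).
have := expV2_gt0 j.+1; have := expV2_gt0 (j + m).+1; nra.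
Qed.

(** The telescoping potential: its increment in [j] is the change of [durfee_term] from [m] to
    [m.+1]. *)
Definition durfee_gap m j : R := (1 - 2 ^- j) * durfee_term m j.

Lemma durfee_gap0 m : durfee_gap m 0 = 0.
Proof. by rewrite /durfee_gap expr0 invr1 subrr mul0r. Qed.

Lemma durfee_gap_ge0 m j : 0 <= durfee_gap m j.
Proof. by rewrite mulr_ge0 ?durfee_term_ge0// subr_ge0 expV2_le1. Qed.

Lemma durfee_gap_le m j : durfee_gap m j <= durfee_term m j.
Proof.
by rewrite ler_piMl ?durfee_term_ge0// gerBl ltW ?expV2_gt0.
Qed.

(** In [durfee_gap m j.+1] the factor [1 - 2 ^- j.+1] cancels the last factor of [eta R j.+1]. With
    [u = 2 ^- j] and [y = 2 ^- (j + m).+1], both sides then equal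
    [durfee_term m j * (u + y - 1) / (1 - y)]. *)
Lemma durfee_termB m j :
  durfee_term m.+1 j - durfee_term m j = durfee_gap m j.+1 - durfee_gap m j.
Proof.
rewrite /durfee_gap /durfee_term addnS addSn !etaS.
have -> : (j.+1 * (j + m).+1 = j * (j + m) + j + (j + m).+1)%N.
  by rewrite mulSn mulnS; lia.
rewrite mulnS [(j + _ * _)%N]addnC !expV2D.
have := expV2S_lt1 j; have := expV2S_lt1 (j + m).
have := eta_neq0 j; have := eta_neq0 (j + m).
move: (2 ^- j.+1) (2 ^- (j + m).+1) (eta R j) (eta R (j + m)) => x y a b.
move: (2 ^- j) (2 ^- (j * (j + m))) => u v b0 a0 y1 x1.
by field; rewrite a0 b0 !subr_eq0 ![1 == _]eq_sym !lt_eqF.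
Qed.

Lemma sum_durfee_term_succ m n :
  \sum_(j < n) durfee_term m.+1 j =
  \sum_(j < n) durfee_term m j + durfee_gap m n.
Proof.
elim: n => [|n IHn]; first by rewrite !big_ord0 durfee_gap0 addr0.
by rewrite !big_ord_recr /= IHn; have := durfee_termB m n; lra.
Qed.

Lemma sum_durfee_term_add m k n :
  \sum_(j < n) durfee_term (m + k) j =
  \sum_(j < n) durfee_term m j + \sum_(i < k) durfee_gap (m + i) n.
Proof.
elim: k => [|k IHk]; first by rewrite big_ord0 addn0 addr0.
by rewrite addnS sum_durfee_term_succ IHk big_ord_recr /= addrA.
Qed.

Lemma sum_expV2S n : \sum_(i < n) 2 ^- i.+1 = 1 - 2 ^- n :> R.
Proof.
elim: n => [|n IHn]; first by rewrite big_ord0 expr0 invr1 subrr.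
by rewrite big_ord_recr /= IHn expV2S; lra.
Qed.

Lemma sum_le_expV2 (F : nat -> R) n :
  (forall i, F i <= 16 * 2 ^- (n + i.+1)) -> \sum_(i < n) F i <= 16 * 2 ^- n.
Proof.
move=> leF; apply: (@le_trans _ _ (\sum_(i < n) 16 * 2 ^- n * 2 ^- i.+1)).
  by apply: ler_sum => i _; rewrite -mulrA -expV2D.
rewrite -mulr_sumr sum_expV2S ler_piMr ?gerBl//; have := expV2_gt0 n; lra.
Qed.

(** Raising the parameter from 1 to [n.+1] shows that the quantity inside the absolute value is
    [t - g]: [t] collects the summands [j > 0] at parameter [n.+1], and [g] the accumulated gaps.
    Both lie between 0 and the bound, so their difference costs no factor 2. *)
Lemma sum_durfee_term_approx n :
  `|\sum_(j < n.+1) durfee_term 1 j - (eta R n.+1)^-1| <= 16 * 2 ^- n.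
Proof.
have := sum_durfee_term_add 1 n n.+1; rewrite add1n.
rewrite [X in X = _]big_ord_recl /= durfee_term0.
set t := \sum_(i < n) durfee_term _ _; set g := \sum_(i < n) durfee_gap _ _.
have t_ge0 : 0 <= t by apply: sumr_ge0 => i _; exact: durfee_term_ge0.
have g_ge0 : 0 <= g by apply: sumr_ge0 => i _; exact: durfee_gap_ge0.
have t_le : t <= 16 * 2 ^- n.
  apply: (@sum_le_expV2 (fun i => durfee_term n.+1 i.+1)) => i.
  apply: le_trans (durfee_term_le _ _) _.
  (* The exponent [i.+1 * (i.+1 + n.+1)] is at least [n + i.+1], so a geometric series dominates. *)
  by rewrite ler_pM2l ?ler_expV2//; nia.
have g_le : g <= 16 * 2 ^- n.
  apply: (@sum_le_expV2 (fun i => durfee_gap (1 + i) n.+1)) => i.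
  apply: le_trans (durfee_gap_le _ _) _; apply: le_trans (durfee_term_le _ _) _.
  by rewrite ler_pM2l ?ler_expV2//; nia.
by rewrite ler_norml => tgE; apply/andP; split; lra.
Qed.

Lemma cvg_expV2 : (fun n => 2 ^- n : R) @ \oo --> (0 : R).
Proof.
under eq_fun do rewrite -exprVn.
by apply: cvg_expr; rewrite gtr0_norm ?invr_gt0// invf_lt1 ?ltr1n.
Qed.

Lemma cvg_series_durfee_term :
  series (durfee_term 1) @ \oo --> (eta_infty R)^-1.
Proof.
rewrite -cvg_shiftS /=.
have etaV : (fun n => (eta R n.+1)^-1) @ \oo --> (eta_infty R)^-1.
  apply: cvgV; first by rewrite gt_eqF ?eta_infty_gt0.
  by rewrite (cvg_shiftS (eta R)); exact: cvgn_eta.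
have errR : (fun n => 16 * 2 ^- n : R) @ \oo --> (0 : R).
  by rewrite -[X in _ --> X](mulr0 16); apply: cvgMl_tmp; exact: cvg_expV2.
apply: (@squeeze_cvgr _ _ _ _ (fun n => (eta R n.+1)^-1 - 16 * 2 ^- n)
  (fun n => (eta R n.+1)^-1 + 16 * 2 ^- n)).
- apply: nearW => n; rewrite /= seriesEord /=.
  by have := sum_durfee_term_approx n; rewrite ler_distl.
- by rewrite -[X in _ --> X]subr0; exact: cvgB.
- by rewrite -[X in _ --> X]addr0; exact: cvgD.
Qed.

(** Since [1 / (2 ^+ j.+1 - 1) = 2 ^- j.+1 / (1 - 2 ^- j.+1)], the denominator turns one [eta R j]
    into [eta R j.+1], while the numerator supplies [2 ^- j] and the factor [1 / 2]. *)
Lemma gamma_termE j :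
  gamma_term R j = eta_infty R / 2 * durfee_term 1 j.
Proof.
rewrite /gamma_term /durfee_term addn1 etaS mulnS mulnn expV2D.
rewrite [(2 ^- j * _)%R]mulrC exprS.
have := eta_neq0 j; have := expV2S_lt1 j; rewrite exprS.
have : 2 ^+ j != 0 :> R by rewrite expf_neq0.
have : 2 ^+ (j ^ 2) != 0 :> R by rewrite expf_neq0.
move: (2 ^+ j) (2 ^+ (j ^ 2)) (eta R j) => x y a y0 x0 x1 a0.
have d0 : 2 * x - 1 != 0.
  apply: contraTneq x1 => /eqP; rewrite subr_eq0 => /eqP ->.
  by rewrite invr1 ltxx.
by field; rewrite ?a0 ?x0 ?y0 ?d0.
Qed.

End DurfeeRectangle.

Theorem theoremA1 (R : realType) :
  [/\ cvgn (@eta R), cvgn (series (@gamma_term R)) & gamma R = 1 / 2].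
Proof.
have cvg_gamma : series (@gamma_term R) @ \oo --> (1 / 2 : R).
  have -> : series (@gamma_term R) =
      (fun n => eta_infty R / 2 * series (durfee_term 1) n).
    apply/funext => n; rewrite !seriesEord /= mulr_sumr.
    by apply: eq_bigr => j _; exact: gamma_termE.
  have -> : 1 / 2 = eta_infty R / 2 * (eta_infty R)^-1.
    by field; rewrite gt_eqF ?eta_infty_gt0.
  by apply: cvgMl_tmp; exact: cvg_series_durfee_term.
split; [exact: cvgn_eta | by apply/cvg_ex; exists (1 / 2) | exact: cvg_lim].
Qed.
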